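(* Let $n$ be a positive integer and consider the random $n$-agent instance of the graphical cake-cutting problem described in the context (random graph $G$ on $L \cup R \cup U$, all queries answered as if every agent had the uniform valuation). Then, with probability (over the random choice of $G$) tending to $1$ as $n \to \infty$, the resulting instance is such that no cake-cutting algorithm in the Robertson-Webb model can output a provably locally proportional allocation after at most $8\left\lfloor\frac{n-1}{32}\right\rfloor^2$ queries.
   Context: Cake-cutting setting: the cake is $[0,1]$; a piece of cake is a finite union of nonempty closed intervals. An instance of the graphical cake-cutting problem consists of an undirected simple graph $G$ on $n$ vertices (agents) and, for each agent $i$, a valuation function $v_i$ on pieces of cake satisfying: $v_i(X)\ge 0$; $v_i([0,1])=1$; additivity over disjoint intervals; divisibility (for any interval $I$ and $0\le\lambda\le1$ there is an interval $I'\subseteq I$ with $v_i(I')=\lambda v_i(I)$). $N(i)$ is the neighbor set of $i$ and $\deg(i)=|N(i)|$. An allocation is a family of pieces $\{A_i\}_{i\in V(G)}$ whose union is $[0,1]$, with $A_i\cap A_j$ of measure zero for $i\neq j$ (each constituent interval has positive measure). It is locally proportional if for every $i$, $v_i(A_i)\ge \frac{1}{\deg(i)}\sum_{j\in N(i)} v_i(A_j)$. Robertson-Webb query model: an algorithm may make eval queries ($\textbf{eval}_i(x,y)$ with $0\le x\le y\le 1$ returns $v_i([x,y])$) and cut queries ($\textbf{cut}_i(x,\alpha)$ with $x,\alpha\in[0,1]$ returns $y$ with $v_i([x,y])=\alpha$, if such $y$ exists); it may compute arbitrarily between queries, and cost is the number of queries. An output allocation is provably locally proportional if it is locally proportional with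 respect to every collection of valuation functions (satisfying the axioms) consistent with all query responses received. The construction: given $n$, let $m$ be the greatest integer multiple of $32$ strictly less than $n$ and $r=n-m\ge 1$. The vertex set is the disjoint union $L\cup R\cup U$ with $|L|=|R|=m/2$, $|U|=r$. Every vertex of $U$ is adjacent to every other vertex of $G$. For each $i\in L$, a subset $S_i\subseteq R$ of size exactly $m/4$ is chosen uniformly at random among all such subsets, independently over $i$, and $i$ is joined to every vertex of $S_i$. There are no other edges. Every query is answered as if each agent's valuation were uniform: $\textbf{eval}_i(x,y)=y-x$ and $\textbf{cut}_i(x,\alpha)=x+\alpha$ (when $x+\alpha\le 1$). All probabilities are over the random choice of the graph only. See claim for the full setting; the objects are defined there. *)

(* Defs.v *)
From mathcomp Require Import all_boot all_order all_algebra.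
From mathcomp Require Import all_classical all_reals all_analysis.
From Stdlib Require List.
Set Implicit Arguments.
Unset Strict Implicit.
Unset Printing Implicit Defensive.
Import Order.TTheory GRing.Theory Num.Theory.
Import numFieldNormedType.Exports.
Local Open Scope classical_set_scope.
Local Open Scope ring_scope.

Definition null_overlap (R : realType) (X Y : set R) : Prop :=
  lebesgue_measure (X `&` Y) = 0%E.

(* Finite unions of nonempty closed intervals of the cake [0, 1]; intervals
   may be single points, and the union over k = 0 intervals is empty. *)
Definition is_piece (R : realType) (X : set R) : Prop :=
  exists (k : nat) (a b : 'I_k -> R),
    (forall j, [&& 0 <= a j, a j <= b j & b j <= 1]) /\
    X = \bigcup_j `[a j, b j]%classic.

Definition is_piece_pos (R : realType) (X : set R) : Prop :=
  exists (k : nat) (a b : 'I_k -> R),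
    (forall j, [&& 0 <= a j, a j < b j & b j <= 1]) /\
    X = \bigcup_j `[a j, b j]%classic.

(* A valuation is a function on pieces of cake; its values on sets that are not
   pieces are irrelevant and left unconstrained. As pieces consist of closed
   intervals, "disjoint" in the additivity axiom is understood up to measure
   zero (otherwise [0, 1/2] and [1/2, 1] would not be disjoint), as it is for
   the parts of an allocation. *)
Record is_valuation (R : realType) (v : set R -> R) : Prop := IsValuation {
  val_ge0 : forall X, is_piece X -> 0 <= v X;
  val_cake : v `[0, 1]%classic = 1;
  val_additive : forall (k : nat) (a b : 'I_k -> R),
    (forall j, [&& 0 <= a j, a j <= b j & b j <= 1]) ->
    (forall i j, i != j -> null_overlap `[a i, b i]%classic `[a j, b j]%classic) ->
    v (\bigcup_j `[a j, b j]%classic) = \sum_(j < k) v `[a j, b j]%classic;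
  val_divisible : forall a b lam : R,
    0 <= a -> a <= b -> b <= 1 -> 0 <= lam <= 1 ->
    exists c d : R,
      [/\ a <= c, c <= d, d <= b & v `[c, d]%classic = lam * v `[a, b]%classic]
}.

Record sgraph (V : finType) := SGraph {
  adj : rel V;
  adj_sym : symmetric adj;
  adj_irr : irreflexive adj
}.

Definition nbrs (V : finType) (G : sgraph V) (i : V) : {set V} :=
  [set j | adj G i j]%SET.

Definition deg (V : finType) (G : sgraph V) (i : V) : nat := #|nbrs G i|.

Definition is_allocation (R : realType) (V : finType) (A : V -> set R) : Prop :=
  [/\ forall i, is_piece_pos (A i),
      \bigcup_i A i = `[0, 1]%classic &
      forall i j, i != j -> null_overlap (A i) (A j)].

Definition locally_proportional (R : realType) (V : finType) (G : sgraph V)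
    (v : V -> set R -> R) (A : V -> set R) : Prop :=
  forall i, v i (A i) >= (deg G i)%:R^-1 * \sum_(j in nbrs G i) v i (A j).

Inductive query (R : realType) (V : finType) :=
  | Eval (i : V) (x y : R) of [&& 0 <= x, x <= y & y <= 1]
  | Cut (i : V) (x alpha : R) of 0 <= x <= 1 & 0 <= alpha <= 1.

(* The response None to a cut query means that no suitable point exists. *)
Definition response (R : realType) := option R.

Definition history (R : realType) (V : finType) :=
  seq (query R V * response R).

Definition correct_response (R : realType) (V : finType) (v : V -> set R -> R)
    (q : query R V) (z : response R) : Prop :=
  match q, z with
  | Eval i x y _, Some w => v i `[x, y]%classic = w
  | Eval _ _ _ _, None => False
  | Cut i x alpha _ _, Some y => x <= y <= 1 /\ v i `[x, y]%classic = alpha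
  | Cut i x alpha _ _, None => ~ exists y : R, x <= y <= 1 /\ v i `[x, y]%classic = alpha
  end.

Definition consistent (R : realType) (V : finType) (v : V -> set R -> R)
    (h : history R V) : Prop :=
  List.Forall (fun e => correct_response v e.1 e.2) h.

Definition provably_locally_proportional (R : realType) (V : finType)
    (G : sgraph V) (h : history R V) (A : V -> set R) : Prop :=
  is_allocation A /\
  forall v : V -> set R -> R,
    (forall i, is_valuation (v i)) -> consistent v h ->
    locally_proportional G v A.

Inductive action (R : realType) (V : finType) :=
  | Ask of query R V
  | Output of (V -> set R).

(* Computation between queries is unrestricted: the next action is an arbitrary
   function of the graph and of the queries and responses so far. *)
Definition algorithm (R : realType) (V : finType) :=
  sgraph V -> history R V -> action R V.

(* Runs alg from history h with at most k further queries; None if the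
   algorithm asks for more. *)
Fixpoint run (R : realType) (V : finType) (oracle : query R V -> response R)
    (alg : algorithm R V) (G : sgraph V) (k : nat) (h : history R V)
    : option (history R V * (V -> set R)) :=
  match alg G h with
  | Output A => Some (h, A)
  | Ask q => if k is k'.+1 then run oracle alg G k' (rcons h (q, oracle q))
             else None
  end.

Definition uniform_oracle (R : realType) (V : finType) (q : query R V)
    : response R :=
  match q with
  | Eval _ x y _ => Some (y - x)
  | Cut _ x alpha _ _ => if x + alpha <= 1 then Some (x + alpha) else None
  end.

Definition outputs_provably_lp (R : realType) (V : finType)
    (oracle : query R V -> response R) (G : sgraph V) (alg : algorithm R V)
    (k : nat) : Prop :=
  exists (h : history R V) (A : V -> set R),
    run oracle alg G k [::] = Some (h, A) /\
    provably_locally_proportional G h A.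

Definition big_m (n : nat) : nat := \max_(k < n | (32 %| k)%N) k.

(* L and R are the two copies of 'I_(m / 2) (in this order), U is 'I_(n - m). *)
Definition vertex (n : nat) : finType :=
  ('I_(big_m n %/ 2) + 'I_(big_m n %/ 2) + 'I_(n - big_m n))%type.

(* The family (S_i), for i in L, of subsets of R. *)
Definition choices (n : nat) : finType :=
  {ffun 'I_(big_m n %/ 2) -> {set 'I_(big_m n %/ 2)}}.

Definition graph_adj (n : nat) (S : choices n) (x y : vertex n) : bool :=
  match x, y with
  | inr u, inr u' => u != u'
  | inr _, inl _ | inl _, inr _ => true
  | inl (inl i), inl (inr j) | inl (inr j), inl (inl i) => j \in S i
  | inl (inl _), inl (inl _) | inl (inr _), inl (inr _) => false
  end.

Lemma graph_adj_sym (n : nat) (S : choices n) : symmetric (graph_adj S).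
Proof. by move=> [[i|i]|i] [[j|j]|j] //=; rewrite eq_sym. Qed.

Lemma graph_adj_irr (n : nat) (S : choices n) : irreflexive (graph_adj S).
Proof. by move=> [[i|i]|i] //=; rewrite eqxx. Qed.

Definition random_graph (n : nat) (S : choices n) : sgraph (vertex n) :=
  SGraph (graph_adj_sym S) (graph_adj_irr S).

Definition uniform_pmf (R : realType) (T : finType) (D : {set T}) (x : T) : R :=
  (x \in D)%:R / #|D|%:R.

(* Each S_i is uniform on the subsets of size m / 4; independence over i is the
   product of the probability mass functions. *)
Definition choices_pmf (R : realType) (n : nat) (S : choices n) : R :=
  \prod_i uniform_pmf R [set T : {set _} | #|T| == (big_m n %/ 4)%N]%SET (S i).

Definition choices_prob (R : realType) (n : nat) (E : choices n -> Prop) : R :=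
  \sum_(S | `[< E S >]) choices_pmf R S.

(* Main.v *)
Require Import Defs.
From mathcomp Require Import all_boot all_order all_algebra.
From mathcomp Require Import all_classical all_reals all_analysis.
From mathcomp Require Import zify ring lra.
Import Order.TTheory GRing.Theory Num.Theory.
Import numFieldNormedType.Exports.
Local Open Scope classical_set_scope.
Local Open Scope ring_scope.

(* Under the uniform valuation local proportionality says that the length of
   A i is superharmonic on the graph, which is connected through U; hence all
   pieces have the same length and every inequality is tight. Therefore, if j is
   a neighbour of i and j' <> i is not, a query about agent i must have cut the cake
   between a slice of A j and a slice of A j': otherwise the adversary moves
   some of i's value from the latter slice to the former. So along a suitable
   order of R, the indicator of S_i changes value at most 1 + 2 t_i times, where
   t_i is the number of queries about i; summed over the h = m / 2 = 16 k
   vertices of L this is at most h + 16 k^2, while typically the number of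
   changes is about h^2 / 2 = 128 k^2. As there are only h! orders but about
   2^(h^2) graphs, a union bound over the orders finishes the proof. *)

(** * Length and shifted valuations *)

Definition len {R : realType} (X : set R) : R := fine (lebesgue_measure X).

(* The density is raised from 1 to 2 on [p, p + d] and lowered to 0 on
   [q, q + d]. *)
Definition shifted_val {R : realType} (p q d : R) (X : set R) : R :=
  len X + len (X `&` `[p, p + d]) - len (X `&` `[q, q + d]).

Section Length.
Context {R : realType}.
Implicit Types (X Y Z : set R) (a b c d p q : R).

Lemma len_itv a b : a <= b -> len `[a, b] = b - a.
Proof.
rewrite /len lebesgue_measure_itv /= lte_fin le_eqVlt => /orP[/eqP->|->//].
by rewrite ltxx subrr.
Qed.

Lemma itv_ccI a b c d :
  `[a, b] `&` `[c, d] = `[Num.max a c, Num.min b d]%classic :> set R.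
Proof.
apply/seteqP; split => x /=; rewrite !in_itv /= ge_max le_min.
  by move=> [/andP[-> ->] /andP[-> ->]].
by move=> /andP[/andP[-> ->] /andP[-> ->]].
Qed.

Lemma len_itvI a b c d : len (`[a, b] `&` `[c, d]) =
  Num.max 0 (Num.min b d - Num.max a c).
Proof.
rewrite itv_ccI /len lebesgue_measure_itv /= lte_fin.
case: ltP => [h|h]; first by rewrite [Num.max 0 _]max_r // subr_ge0 ltW.
by rewrite [Num.max 0 _]max_l // subr_le0.
Qed.

Lemma is_piece_posW {X} : is_piece_pos X -> is_piece X.
Proof.
move=> [k [a [b [h ->]]]]; exists k, a, b; split => // j.
by have /and3P[-> /ltW-> ->] := h j.
Qed.

Lemma itv_is_piece {a b} : 0 <= a -> a <= b -> b <= 1 -> is_piece `[a, b].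
Proof.
move=> a0 ab b1; exists 1%N, (fun=> a), (fun=> b); split=> [_|].
  by rewrite a0 ab b1.
by apply/seteqP; split => [x hx|x [] //]; exists ord0.
Qed.

Lemma is_piece_measurable {X} : is_piece X -> measurable X.
Proof.
move=> [k [a [b [_ ->]]]]; apply: fin_bigcup_measurable => [|j _].
  exact: finite_finset.
exact: measurable_itv.
Qed.

Lemma is_piece_sub01 {X} : is_piece X -> X `<=` `[0, 1].
Proof.
move=> [k [a [b [h ->]]]] x [j _] /=; rewrite !in_itv /= => /andP[h1 h2].
have /and3P[h3 _ h4] := h j.
by rewrite (le_trans h3 h1) (le_trans h2 h4).
Qed.

Lemma sub01_fin_num X : measurable X -> X `<=` `[0, 1] ->
  lebesgue_measure X \is a fin_num.
Proof.
move=> mX sX; rewrite ge0_fin_numE //.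
apply: (@le_lt_trans _ _ (lebesgue_measure `[0%R, 1%R]%classic)).
  by apply: le_measure; rewrite ?inE.
by rewrite lebesgue_measure_itv /= lte_fin ltr01 -EFinB ltry.
Qed.

Lemma len_ge0 X : 0 <= len X.
Proof. exact: fine_ge0. Qed.

Lemma le_len {X Y} : measurable X -> measurable Y -> Y `<=` `[0, 1] ->
  X `<=` Y -> len X <= len Y.
Proof.
move=> mX mY sY XY; apply: fine_le; last by apply: le_measure; rewrite ?inE.
- by apply: sub01_fin_num => //; apply: subset_trans sY.
- exact: sub01_fin_num.
Qed.

Lemma null_overlap_sub {X Y X' Y'} : measurable X -> measurable Y ->
  measurable X' -> measurable Y' -> X' `<=` X -> Y' `<=` Y ->
  null_overlap X Y -> null_overlap X' Y'.
Proof.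
move=> mX mY mX' mY' sX sY; apply: subset_measure0.
- exact: (measurableI X' Y').
- exact: (measurableI X Y).
- exact: setISS.
Qed.

(** Inclusion-exclusion: [F i] meets the union of the remaining sets in a null set, and finite
    measures allow that term to be subtracted. *)
Lemma measure_bigU_null {I : eqType} (s : seq I) (F : I -> set R) :
  uniq s -> (forall i, measurable (F i)) ->
  (forall i, lebesgue_measure (F i) < +oo)%E ->
  (forall i j, i != j -> null_overlap (F i) (F j)) ->
  lebesgue_measure (\big[setU/set0]_(i <- s) F i) =
    (\sum_(i <- s) lebesgue_measure (F i))%E.
Proof.
move=> us mF fF nF; elim: s us => [|i s IHs] /=; first by rewrite !big_nil measure0.
move=> /andP[si us]; rewrite !big_cons -IHs //.
set B := \big[_/_]_(_ <- _) _.
have mB : measurable B by apply: bigsetU_measurable.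
have FB0 : lebesgue_measure (F i `&` B) = 0%E.
  rewrite /B {B IHs mB us}; elim: s si => [|j s IHs].
    by rewrite big_nil setI0 measure0.
  rewrite inE negb_or big_cons setIUr => /andP[ij si].
  rewrite measureU0; first exact: nF.
  - exact: (measurableI (F i) (F j)).
  - by apply: (measurableI (F i)) => //; exact: bigsetU_measurable.
  - exact: IHs.
rewrite measureUfinl; [|exact: mF|exact: mB|exact: fF].
by rewrite [X in (_ - X)%E]FB0 sube0.
Qed.

Lemma len_bigcup (k : nat) (F : 'I_k -> set R) :
  (forall i, measurable (F i)) -> (forall i, F i `<=` `[0, 1]) ->
  (forall i j, i != j -> null_overlap (F i) (F j)) ->
  len (\bigcup_i F i) = \sum_i len (F i).
Proof.
move=> mF sF nF.
have ffin i : lebesgue_measure (F i) \is a fin_num by exact: sub01_fin_num.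
have -> : \bigcup_i F i = \big[setU/set0]_(i <- index_enum 'I_k) F i.
  rewrite -bigcup_seq; apply: eq_bigcupl; split => // i _ /=.
  exact: mem_index_enum.
rewrite /len measure_bigU_null ?index_enum_uniq // => [|i].
  by rewrite sum_fine.
by rewrite -ge0_fin_numE.
Qed.

Lemma shifted_val_itv p q d a b : a <= b ->
  shifted_val p q d `[a, b] = b - a +
    Num.max 0 (Num.min b (p + d) - Num.max a p) -
    Num.max 0 (Num.min b (q + d) - Num.max a q).
Proof. by move=> ab; rewrite /shifted_val !len_itvI len_itv. Qed.

(** Makes the uniform valuation a member of the shifted family, so that facts about [shifted_val]
    cover it too. *)
Lemma shifted_valpp p d : shifted_val p p d = len.
Proof. by apply/funext => X; rewrite /shifted_val addrK. Qed.

Lemma shifted_val_ge0 p q d X : is_piece X -> 0 <= shifted_val p q d X.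
Proof.
move=> pX; have mX := is_piece_measurable pX; have sX := is_piece_sub01 pX.
rewrite /shifted_val addrAC addr_ge0 ?len_ge0 // subr_ge0.
apply: le_len => //.
by apply: (measurableI X) => //; exact: measurable_itv.
Qed.

Lemma shifted_val_is_valuation p q d : 0 <= d ->
  0 <= p -> p + d <= 1 -> 0 <= q -> q + d <= 1 ->
  is_valuation (shifted_val p q d).
Proof.
move=> d0 p0 pd q0 qd; split.
- exact: shifted_val_ge0.
- rewrite shifted_val_itv // !min_r // !max_r ?subr_ge0 ?lerDl //.
  by ring.
- move=> k a b h nI.
  have mI c e : measurable (`[c, e]%classic : set R) by exact: measurable_itv.
  have s01 j : `[a j, b j] `<=` `[0, 1].
    by have /and3P[h1 h2 h3] := h j; apply: is_piece_sub01; exact: itv_is_piece.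
  rewrite /shifted_val !setI_bigcupl !len_bigcup //.
  + by rewrite -big_split /= -sumrB.
  + by move=> i; apply: measurableI.
  + by move=> i; apply: subset_trans (s01 i); apply: subIsetl.
  + move=> i j ij; apply: null_overlap_sub (nI i j ij) => //; try exact: subIsetl;
    exact: (measurableI _ _ (mI _ _) (mI _ _)).
  + by move=> i; apply: measurableI.
  + by move=> i; apply: subset_trans (s01 i); apply: subIsetl.
  + move=> i j ij; apply: null_overlap_sub (nI i j ij) => //; try exact: subIsetl;
    exact: (measurableI _ _ (mI _ _) (mI _ _)).
- move=> a b lam a0 ab b1 /andP[l0 l1].
  (* The left end stays at [a]; the right end comes from the intermediate value theorem for the
     cumulative value, whose closed formula is continuous on all of [R]. *)
  pose f (t : R) := t - a +
    Num.max 0 (Num.min t (p + d) - Num.max a p) -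
    Num.max 0 (Num.min t (q + d) - Num.max a q).
  have fE t : a <= t -> shifted_val p q d `[a, t] = f t.
    exact: shifted_val_itv.
  have fa : f a = 0.
    have m0 r e : Num.max 0 (Num.min a r - Num.max a e) = 0.
      by rewrite [Num.max 0 _]max_l // subr_le0 ge_min le_max lexx.
    by rewrite /f !m0 subrr subr0 addr0.
  have fb : 0 <= f b by rewrite -fE //; apply/shifted_val_ge0/itv_is_piece.
  have cf : continuous f.
    have cm r c e : {for c, continuous (fun t : R => Num.max 0 (Num.min t r - e))}.
      apply: (@continuous_max R R (fun=> 0) _ c); first exact: cvg_cst.
      apply: continuousB; last exact: cvg_cst.
      by apply: continuous_min; [exact: cvg_id|exact: cvg_cst].
    move=> c; apply: cvgB; last exact: cm.
    apply: cvgD; last exact: cm.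
    by apply: cvgB; [exact: cvg_id|exact: cvg_cst].
  have [||t] := @IVT R f a b (lam * f b) ab.
  + exact: continuous_subspaceT.
  + rewrite fa min_l // max_r // mulr_ge0 //=.
    by rewrite ler_piMl.
  rewrite in_itv /= => /andP[at_ tb] ft.
  by exists a, t; rewrite !fE.
Qed.
End Length.

(** * The adversary *)

Definition profile {R : realType} {V : finType} (i0 : V) (p q d : R) (i : V) :=
  if i == i0 then shifted_val p q d else len.

(* A superset of the points at which the answers pin down the cumulative
   valuation of agent i; for a failed cut, x + alpha > 1 is harmless. *)
Definition query_points {R : realType} {V : finType} (i : V) (q : query R V) : seq R :=
  match q with
  | Eval i' x y _ => if i' == i then [:: x; y] else [::]
  | Cut i' x alpha _ _ => if i' == i then [:: x; x + alpha] else [::]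
  end.

Definition cut_points {R : realType} {V : finType} (i : V) (h : history R V) : seq R :=
  flatten [seq query_points i e.1 | e <- h].

(** With the preceding bit as an argument, a bit string is determined by [b] and the positions of
    its changes. *)
Fixpoint changes (b : bool) (s : seq bool) : nat :=
  if s is c :: s' then ((b != c) + changes c s')%N else 0%N.

(** Each change is paid for by a point of [C] between two consecutive values of [f]; these gaps are
    disjoint, so no point pays twice. *)
Lemma changes_le_count {R : realType} {I : Type} (f : I -> R) (T : pred I)
    (C : seq R) j s :
  path (fun j j' => (f j < f j') &&
    ((T j != T j') ==> has (fun c => f j < c < f j') C)) j s ->
  (changes (T j) (map T s) <= count (fun c => f j < c)%R C)%N.
Proof.
elim: s j => //= j' s IHs j /andP[/andP[jj' /implyP hC] /IHs ps].
apply: (leq_trans (leq_add (leqnn _) ps)).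
case: eqP hC => [_ _|_ /(_ isT)] /=.
  by apply: sub_count => c /=; apply: lt_trans.
rewrite has_count => hC; apply: (leq_trans (leq_add hC (leqnn _))).
rewrite -count_predUI [X in (_ + X)%N](@eq_count _ _ pred0) ?count_pred0 => [|c /=].
  rewrite addn0; apply: sub_count => c /= /orP[/andP[]//|].
  exact: lt_trans.
by apply/negP => /andP[/andP[_ h1] /(lt_trans h1)]; rewrite ltxx.
Qed.

Section Adversary.
Context {R : realType} {V : finType}.
Implicit Types (p q d m : R) (i : V) (h : history R V).

(** No endpoint lies in the open gap from [m] to [m'], so [[x, y]] covers the whole slice or a null
    part of it, wherever in the gap the slice lies. *)
Lemma overlap_outside p d m m' x y : 0 <= d -> m <= p -> p + d <= m' ->
  (x <= m) || (m' <= x) -> (y <= m) || (m' <= y) -> x <= y ->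
  Num.max 0 (Num.min y (p + d) - Num.max x p) =
  if (x <= m) && (m' <= y) then d else 0.
Proof.
move=> d0 mp pm hx hy xy; rewrite /Order.max /Order.min.
case: (leP x m) hx => /= xm hx; case: (leP m' y) hy => /= my hy;
  case: (ltP y (p + d)) => ?; case: (ltP x p) => ?; case: ltP => ?;
  rewrite ?orbF in hy; lra.
Qed.

Lemma shifted_val_outside p q d m m' x y : 0 <= d ->
  m <= p -> p + d <= m' -> m <= q -> q + d <= m' ->
  (x <= m) || (m' <= x) -> (y <= m) || (m' <= y) -> x <= y ->
  shifted_val p q d `[x, y] = y - x.
Proof.
move=> d0 mp pm mq qm hx hy xy; rewrite shifted_val_itv //.
by rewrite !(@overlap_outside _ _ m m') // addrK.
Qed.

(** Needed for failed cuts, where [y] is arbitrary and may fall inside the gap. *)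
Lemma shifted_val_le p q d m m' x y : 0 <= d ->
  m <= p -> p + d <= m' -> m <= q -> q + d <= m' -> m' <= 1 ->
  (x <= m) || (m' <= x) -> x <= y -> y <= 1 ->
  shifted_val p q d `[x, y] <= 1 - x.
Proof.
move=> d0 mp pm mq qm m1 hx xy y1; case/orP: (hx) => xm; last first.
  rewrite (@shifted_val_outside _ _ _ m m') ?lerD2r //.
  by rewrite (le_trans xm xy) orbT.
have hP : Num.max 0 (Num.min y (p + d) - Num.max x p) <= d.
  rewrite ge_max d0 /= lerBlDl (@le_trans _ _ (p + d)) ?ge_min ?lexx ?orbT //.
  by rewrite lerD2r le_max lexx orbT.
(* The part of [[q, q + d]] beyond [y] has length at most [1 - y], since [q + d <= 1]. *)
have hQ : d - (1 - y) <= Num.max 0 (Num.min y (q + d) - Num.max x q).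
  rewrite (max_r (le_trans xm mq)) le_max; apply/orP; right.
  by rewrite /Order.min; case: ltP => ?; lra.
by rewrite shifted_val_itv //; lra.
Qed.

Lemma correct_profile i0 p q d m m' (qu : query R V) : 0 <= d ->
  m <= p -> p + d <= m' -> m <= q -> q + d <= m' -> m' <= 1 ->
  {in query_points i0 qu, forall c, (c <= m) || (m' <= c)} ->
  correct_response (profile i0 p q d) qu (uniform_oracle qu).
Proof.
move=> d0 mp pm mq qm m1; rewrite /profile.
case: qu => [i x y /and3P[x0 xy y1]|i x alpha /andP[x0 x1] /andP[a0 a1]] /=.
  case: eqP => _ hc; last by rewrite len_itv.
  by apply: (@shifted_val_outside _ _ _ m m') => //; apply: hc;
    rewrite !inE eqxx ?orbT.
case: eqP => _ hc; case: ifP => xa.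
- rewrite lerDl a0 xa; split => //.
  rewrite (@shifted_val_outside _ _ _ m m') ?lerDl //; first by rewrite addrAC subrr add0r.
    by apply: hc; rewrite inE eqxx.
  by apply: hc; rewrite !inE eqxx orbT.
- move=> [y [/andP[xy y1]]] hy.
  have := @shifted_val_le p q d m m' x y d0 mp pm mq qm m1 _ xy y1.
  rewrite hy => /(_ (hc x _)); rewrite inE eqxx => /(_ isT); lra.
- by rewrite lerDl a0 xa len_itv ?lerDl // addrAC subrr add0r.
- move=> [y [/andP[xy y1]]]; rewrite len_itv //; lra.
Qed.

Definition uniform_history h := forall e, List.In e h -> e.2 = uniform_oracle e.1.

Lemma consistent_profile i0 p q d m m' h : uniform_history h -> 0 <= d ->
  m <= p -> p + d <= m' -> m <= q -> q + d <= m' -> m' <= 1 ->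
  {in cut_points i0 h, forall c, (c <= m) || (m' <= c)} ->
  consistent (profile i0 p q d) h.
Proof.
move=> uh d0 mp pm mq qm m1 hc; apply/List.Forall_forall => e eh.
rewrite uh //; apply: correct_profile mp pm mq qm m1 _ => // c ce; apply: hc.
elim: h eh {uh} => //= e' h IHh [->|/IHh]; rewrite mem_cat ?ce //.
by move=> ->; rewrite orbT.
Qed.

Lemma profile_is_valuation i0 p q d i : 0 <= d ->
  0 <= p -> p + d <= 1 -> 0 <= q -> q + d <= 1 ->
  is_valuation (profile i0 p q d i).
Proof.
move=> d0 p0 pd q0 qd; rewrite /profile; case: eqP => _.
  exact: shifted_val_is_valuation.
by rewrite -(shifted_valpp p d); exact: shifted_val_is_valuation.
Qed.

Lemma run_history (oracle : query R V -> response R) (alg : algorithm R V) G k h0 h A :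
  run oracle alg G k h0 = Some (h, A) ->
  (forall e, List.In e h0 -> e.2 = oracle e.1) ->
  (forall e, List.In e h -> e.2 = oracle e.1) /\ (size h <= size h0 + k)%N.
Proof.
elim: k h0 => [|k IHk] h0 /=; case: (alg G h0) => [qu|A'] //.
- by move=> [<- _] uh0; rewrite addn0.
- move=> /IHk; rewrite size_rcons addSnnS => IH uh0; apply: IH => e.
  by rewrite -cats1 => /(@List.in_app_or _ _ _ _)[/uh0//|[<-//|//]].
- by move=> [<- _] uh0; rewrite leq_addr.
Qed.

Lemma sum_size_query_points (qu : query R V) :
  (\sum_i size (query_points i qu) <= 2)%N.
Proof.
have [i hi] : exists i, forall j, j != i -> query_points j qu = [::].
  case: qu => [i x y hq|i x al h1 h2]; exists i => j ij /=;
  by rewrite eq_sym (negbTE ij).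
rewrite (bigD1 i) //= big1 ?addn0 => [|j /hi->//].
by case: qu {hi} => *; rewrite /=; case: ifP.
Qed.

Lemma sum_size_cut_points h :
  (\sum_i size (cut_points i h) <= 2 * size h)%N.
Proof.
elim: h => [|e h IHh]; first by rewrite big1.
rewrite (eq_bigr (fun i => size (query_points i e.1) + size (cut_points i h))%N).
  by rewrite big_split /= mulnS leq_add // sum_size_query_points.
by move=> i _; rewrite /cut_points /= size_cat.
Qed.

Context (G : sgraph V) (h : history R V) (A : V -> set R) (u : V).
Context (u_univ : forall i, i != u -> adj G u i).
Context (uh : uniform_history h).
Context (plp : provably_locally_proportional G h A).

Let alloc : is_allocation A. Proof. by case: plp. Qed.

Lemma alloc_measurable i : measurable (A i).
Proof. by case: alloc => pA _ _; exact: is_piece_measurable (is_piece_posW (pA i)). Qed.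

Lemma alloc_sub01 i : A i `<=` `[0, 1].
Proof. by case: alloc => pA _ _; exact: is_piece_sub01 (is_piece_posW (pA i)). Qed.

Lemma alloc_len_superharmonic i : (0 < deg G i)%N ->
  \sum_(j in nbrs G i) (len (A j) - len (A i)) <= 0.
Proof.
(* Width 0 makes the profile uniform, and the empty gap [m = m' = 0] is avoided by every point. *)
move=> di; have /(_ i) : locally_proportional G (profile i 0 0 0) A.
  apply: (proj2 plp) => [j|].
    by apply: profile_is_valuation; rewrite ?addr0 ?ler01 ?lexx.
  by apply: (@consistent_profile _ _ _ _ 0 0); rewrite ?addr0 ?ler01 // => c _;
    exact: le_total.
have pE j : profile i 0 0 0 j = len.
  by rewrite /profile shifted_valpp if_same.
rewrite pE ler_pdivrMl ?ltr0n //.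
by rewrite sumrB sumr_const subr_le0 mulr_natl.
Qed.

Lemma univ_deg i : i != u -> (0 < deg G i)%N.
Proof.
by move=> iu; rewrite card_gt0; apply/set0Pn; exists u; rewrite inE adj_sym u_univ.
Qed.

(* A superharmonic function on a connected graph is constant; here a minimum
   propagates through the universal vertex u. *)
Lemma alloc_len_const i j : len (A i) = len (A j).
Proof.
suff to_u k : len (A k) = len (A u) by rewrite !to_u.
have min_eq (a b : V) : (forall l, len (A a) <= len (A l)) -> adj G a b ->
    len (A b) = len (A a).
  move=> mina ab; have da : (0 < deg G a)%N.
    by rewrite card_gt0; apply/set0Pn; exists b; rewrite inE.
  have s0 : \sum_(l in nbrs G a) (len (A l) - len (A a)) = 0.
    apply/eqP; rewrite eq_le alloc_len_superharmonic //=.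
    by apply: sumr_ge0 => l _; rewrite subr_ge0.
  apply/eqP; rewrite -subr_eq0; apply/eqP.
  by apply: (psumr_eq0P _ s0); rewrite ?inE // => l _; rewrite subr_ge0.
have [a mina] : exists a, forall l, len (A a) <= len (A l).
  have [a _ amin] := @arg_minP _ R V u xpredT (fun l => len (A l)) isT.
  by exists a => l; apply: amin.
have ua : len (A u) = len (A a).
  by have [->//|au] := eqVneq a u; apply: min_eq; rewrite // adj_sym u_univ.
have [->//|ku] := eqVneq k u.
by apply: min_eq; [move=> l; rewrite ua|exact: u_univ].
Qed.

(** An empty piece would have length 0, and then so would all pieces; but the piece containing the
    point 0 includes an interval of positive length. *)
Lemma alloc_contains_itv j :
  exists a b : R, [/\ 0 <= a, a < b, b <= 1 & `[a, b] `<=` A j].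
Proof.
case: alloc => pA uA _; have [[|k] [a [b [hab Aj]]]] := pA j; last first.
  have /and3P[h1 h2 h3] := hab ord0.
  by exists (a ord0), (b ord0); split => //; rewrite Aj => x hx; exists ord0.
have Aj0 : len (A j) = 0.
  rewrite Aj; suff -> : \bigcup_i `[a i, b i]%classic = set0 by rewrite /len measure0.
  by apply/seteqP; split => // x [[]].
have : `[0%R, 1%R]%classic (0 : R) by rewrite /= in_itv /= lexx ler01.
rewrite -uA => -[i _]; have [k [a' [b' [hab' Ai]]]] := pA i.
rewrite {1}Ai => -[l _ _]; have /and3P[h1 h2 h3] := hab' l.
have : len `[a' l, b' l] <= len (A i).
  apply: le_len; [exact: measurable_itv|exact: alloc_measurable|
    exact: alloc_sub01|].
  by rewrite Ai => x hx; exists l.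
by rewrite (alloc_len_const i j) Aj0 len_itv ?(ltW h2) // subr_le0 leNgt h2.
Qed.

Lemma len_setI_alloc j X : measurable X -> X `<=` A j -> forall l,
  len (A l `&` X) = if l == j then len X else 0.
Proof.
move=> mX sX l; case: eqVneq => [->|lj]; first by rewrite setIidr.
rewrite /len (_ : lebesgue_measure _ = 0%E) //.
case: alloc => _ _ /(_ l j lj) nA.
have nX : null_overlap (A l) X.
  by apply: null_overlap_sub nA => //; exact: alloc_measurable.
exact: nX.
Qed.

(* Without such a cut point, moving the valuation that i has for a slice of A j'
   onto a slice of A j is compatible with the answers; it increases the value of
   the neighbours' pieces and leaves that of A i unchanged, although the uniform
   valuation already gave equality. *)
Lemma cut_between_pieces i j j' p q d m m' : i != u -> adj G i j ->
  ~~ adj G i j' -> j' != i -> 0 < d ->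
  `[p, p + d] `<=` A j -> `[q, q + d] `<=` A j' ->
  0 <= m -> m <= p -> p + d <= m' -> m <= q -> q + d <= m' -> m' <= 1 ->
  exists2 c, c \in cut_points i h & m < c < m'.
Proof.
move=> iu ij nij' j'i d0 Pj Qj' m0 mp pm mq qm m1.
apply: contrapT => nocut.
have /(_ i) : locally_proportional G (profile i p q d) A.
  apply: (proj2 plp) => [l|].
    by apply: profile_is_valuation; lra.
  apply: consistent_profile mp pm mq qm m1 _ => //; first exact: ltW.
  move=> c hc; rewrite -[_ || _]negbK negb_or -!ltNge; apply/negP => mc.
  by apply: nocut; exists c.
rewrite /profile eqxx /shifted_val.
have jj' : j == j' = false by apply: contraNF nij' => /eqP<-.
have ji : j == i = false by apply/negP => /eqP ji; rewrite ji adj_irr in ij.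
have mI a b : measurable (`[a, b]%classic : set R) by exact: measurable_itv.
have dG : 0 < (deg G i)%:R :> R by rewrite ltr0n (univ_deg _ iu).
rewrite ler_pdivrMl //.
(* To [i], each neighbour's piece is worth [len (A i)], that of [j] is worth [d] more, and the
   lowered slice lies in no neighbour's piece. Summing gives the contradiction [d <= 0]. *)
rewrite (eq_bigr (fun l => len (A i) + if l == j then d else 0)) => [|l]; last first.
  rewrite inE => il.
  have lj' : l == j' = false by apply: contraNF nij' => /eqP<-.
  rewrite !(len_setI_alloc _ _ (mI _ _) Pj) !(len_setI_alloc _ _ (mI _ _) Qj').
  rewrite lj' subr0 (alloc_len_const l i) len_itv ?lerDl ?(ltW d0) //.
  by rewrite addrAC subrr add0r.
rewrite !(len_setI_alloc _ _ (mI _ _) Pj) !(len_setI_alloc _ _ (mI _ _) Qj').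
rewrite [i == j]eq_sym ji [i == j']eq_sym (negbTE j'i) subr0 addr0.
rewrite big_split /= sumr_const -[len _ *+ _]mulr_natl -/(deg G i).
rewrite (bigD1 j) ?inE //= eqxx big1 => [|l /andP[_ /negbTE->]] //; lra.
Qed.

(* Pieces need not be connected: ordering the agents by the midpoint of one
   interval inside each piece is enough. *)
Lemma pieces_order {I : finType} (e : I -> V) : injective e ->
  exists2 s : seq I, perm_eq s (enum I) &
    forall i, i != u -> (forall j, e j != i) ->
      (changes false [seq adj G i (e j) | j <- s] <= (size (cut_points i h)).+1)%N.
Proof.
move=> einj; have /choice[ab hab] j : exists ab : R * R,
    [/\ 0 <= ab.1, ab.1 < ab.2, ab.2 <= 1 & `[ab.1, ab.2] `<=` A (e j)].
  by have [a [b hab]] := alloc_contains_itv (e j); exists (a, b).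
pose mid j := ((ab j).1 + (ab j).2) / 2.
have ordered j j' : j != j' -> mid j <= mid j' -> (ab j).2 <= (ab j').1.
  move=> jj'; rewrite /mid; have [h1 h2 h3 h4] := hab j; have [h1' h2' h3' h4'] := hab j'.
  have : null_overlap `[(ab j).1, (ab j).2] `[(ab j').1, (ab j').2].
    case: alloc => _ _ /(_ (e j) (e j')); rewrite (inj_eq einj) => /(_ jj') nA.
    by apply: null_overlap_sub nA => //; exact: alloc_measurable.
  move=> /(congr1 fine); rewrite -/(len _) len_itvI /= /Order.min /Order.max.
  by case: (ltP _ (ab j').2) => ?; case: (ltP _ (ab j').1) => ?; case: ltP => ? *; lra.
pose le_mid := [rel j j' | mid j <= mid j'].
exists (sort le_mid (enum I)) => [|i iu ei]; first by rewrite perm_sort.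
have : sorted (fun j j' => (mid j < mid j') &&
    ((adj G i (e j) != adj G i (e j')) ==>
       has (fun c => mid j < c < mid j') (cut_points i h))) (sort le_mid (enum I)).
  have : sorted [rel j j' | le_mid j j' && (j != j')] (sort le_mid (enum I)).
    apply: pairwise_sorted; rewrite pairwise_relI -uniq_pairwise sort_uniq enum_uniq.
    rewrite andbT -sorted_pairwise; last by move=> x y z; exact: le_trans.
    by apply: sort_sorted => x y; exact: le_total.
  apply: sub_sorted => j j' /= /andP[mj jj']; have hj := ordered _ _ jj' mj.
  have [h1 h2 h3 h4] := hab j; have [h1' h2' h3' h4'] := hab j'.
  apply/andP; split; first by rewrite /mid; lra.
  (* Half the shorter length: the slice starting at [mid j] and the one ending at [mid j'] then stay
     inside their pieces and between the two midpoints. *)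
  pose d := Num.min (((ab j).2 - (ab j).1) / 2) (((ab j').2 - (ab j').1) / 2).
  have d0 : 0 < d by rewrite lt_min !divr_gt0 ?subr_gt0.
  have dl : d <= ((ab j).2 - (ab j).1) / 2 by rewrite ge_min lexx.
  have dr : d <= ((ab j').2 - (ab j').1) / 2 by rewrite ge_min lexx orbT.
  have sl : `[mid j, mid j + d] `<=` A (e j).
    apply: subset_trans h4 => x /=; rewrite !in_itv /= /mid => /andP[? ?].
    by apply/andP; split; lra.
  have sr : `[mid j' - d, mid j' - d + d] `<=` A (e j').
    apply: subset_trans h4' => x /=; rewrite !in_itv /= /mid => /andP[? ?].
    by apply/andP; split; lra.
  apply/implyP => hadj; apply/hasP.
  case: (boolP (adj G i (e j))) hadj => [ij|nij] /=; rewrite ?eqbF_neg ?negbK => hadj.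
    by apply: (cut_between_pieces _ _ _ _ _ _ _ _ iu ij hadj (ei _) d0 sl sr); rewrite /mid; lra.
  by apply: (cut_between_pieces _ _ _ _ _ _ _ _ iu hadj nij (ei _) d0 sr sl); rewrite /mid; lra.
case: (sort _ _) => [|j s] //= hp.
have hle := @changes_le_count R I mid (fun j => adj G i (e j)) _ _ _ hp.
(* The extra 1 is the possible change from the initial [false] to the first bit. *)
rewrite -[(size _).+1]add1n leq_add //; first by case: (adj _ _ _).
exact: leq_trans hle (count_size _ _).
Qed.
End Adversary.

(** * Counting alternations *)

Section Counting.
Context {R : realType}.
Local Notation x := (8%:R^-1 : R).

(** The next bit repeats the previous one or differs from it, which gives a factor [1 + x] per
    position. *)
Lemma sum_changes h b :
  \sum_(t : h.-tuple bool) x ^+ changes b t = (1 + x) ^+ h.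
Proof.
elim: h b => [|h IHh] b.
  by rewrite expr0 (big_pred1 [tuple]) // => t; rewrite [t]tuple0 inE eqxx.
rewrite (reindex (fun p : bool * h.-tuple bool => cons_tuple p.1 p.2)) /=; last first.
  exists (fun t : h.+1.-tuple bool => (thead t, behead_tuple t)) => [[c t] _|t _] /=.
    by rewrite theadE; congr pair; apply/val_inj.
  by apply/val_inj; case: t => -[].
rewrite -(pair_bigA _ (fun (c : bool) (t : h.-tuple bool) => x ^+ ((b != c) + changes c t))) /=.
under eq_bigr => c _ do (under eq_bigr => t _ do rewrite exprD; rewrite -big_distrr /= IHh).
by rewrite -big_distrl /= big_bool; case: b; rewrite exprS /= ?expr0 ?expr1 // addrC.
Qed.

Lemma sum_changes_sets h (s : h.-tuple 'I_h) : perm_eq s (enum 'I_h) ->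
  \sum_(T : {set 'I_h}) x ^+ changes false [seq j \in T | j <- s] = (1 + x) ^+ h.
Proof.
move=> ps; rewrite -(sum_changes _ false).
have inj : injective (fun T : {set 'I_h} => map_tuple (fun j => j \in T) s).
  move=> T T' /(congr1 val) /= /eq_in_map TT'; apply/setP => j.
  by apply: TT'; rewrite (perm_mem ps) mem_enum.
have [g gK Kg] : bijective (fun T : {set 'I_h} => map_tuple (fun j => j \in T) s).
  apply: inj_card_bij inj _.
  by rewrite card_tuple card_bool -cardsT -powersetT card_powerset cardsT card_ord.
by rewrite [RHS](reindex _ (onW_bij _ (Bijective gK Kg))).
Qed.

(** By Pascal's rule, ['C(2a + 2, a + 1)] is a sum of two terms that are both at least
    ['C(2a, a)]. *)
Lemma central_binomial a : (2 ^ a <= 'C(2 * a, a))%N.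
Proof.
elim: a => // a IHa; rewrite mul2n doubleS binS expnS mul2n -addnn.
apply: leq_add; apply: (leq_trans IHa); rewrite -mul2n.
  by rewrite binS leq_addl.
by rewrite leq_bin2l.
Qed.

Lemma uniform_pmf_ge0 (T : finType) (D : {set T}) t : 0 <= uniform_pmf R D t.
Proof. by rewrite /uniform_pmf divr_ge0. Qed.

Lemma sum_uniform_pmf (T : finType) (D : {set T}) : (0 < #|D|)%N ->
  \sum_t uniform_pmf R D t = 1.
Proof.
move=> D0; rewrite -big_distrl /= -natr_sum -big_mkcond sum1_card divff //.
by rewrite pnatr_eq0 -lt0n.
Qed.

(** An event about the graph alone: the quantified order stands for the unknown order of the pieces
    of R, whatever the algorithm and its output. *)
Definition few_changes h (N : nat) (S : {ffun 'I_h -> {set 'I_h}}) : bool :=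
  [exists s : h.-tuple 'I_h, perm_eq s (enum 'I_h) &&
    (\sum_i changes false [seq j \in S i | j <- s] <= N)%N].

(* Union bound over the h! <= h^h orders, and for each of them Markov's
   inequality for x^(number of changes). *)
Lemma prob_few_changes h N (D : {set {set 'I_h}}) :
  \sum_(S | few_changes h N S) \prod_i uniform_pmf R D (S i) <=
  (h ^ h)%:R * (8%:R ^+ N * ((1 + x) ^+ h / #|D|%:R) ^+ h).
Proof.
pose ch (s : h.-tuple 'I_h) (T : {set 'I_h}) := changes false [seq j \in T | j <- s].
have x0 : 0 <= x by rewrite invr_ge0.
have pt_ge0 s S : 0 <= 8%:R ^+ N * \prod_i (uniform_pmf R D (S i) * x ^+ ch s (S i)).
  by rewrite mulr_ge0 ?exprn_ge0 // prodr_ge0 // => i _;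
    rewrite mulr_ge0 ?uniform_pmf_ge0 ?exprn_ge0.
apply: (@le_trans _ _ (\sum_(S : {ffun 'I_h -> {set 'I_h}})
  \sum_(s : h.-tuple 'I_h | perm_eq s (enum 'I_h))
    8%:R ^+ N * \prod_i (uniform_pmf R D (S i) * x ^+ ch s (S i)))).
  rewrite big_mkcond; apply: ler_sum => S _; case: ifP => [|_]; last first.
    by apply: sumr_ge0 => s _.
  move=> /existsP[s /andP[ps hN]].
  (* Only the term of the witness [s] is kept; it is at least the probability of [S], because [N]
     bounds the number of changes. *)
  rewrite (bigD1 s) //= [X in _ * X + _](@big_split R) /= prodrXr mulrCA.
  apply: (@le_trans _ _ (\prod_i uniform_pmf R D (S i))) => //.
  rewrite -[leLHS]addr0 lerD ?sumr_ge0 //.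
  rewrite ler_peMr ?prodr_ge0 // => [i _|]; first exact: uniform_pmf_ge0.
  rewrite exprVn ler_pdivlMr ?exprn_gt0 // mul1r.
  by rewrite ler_weXn2l // ler1n.
rewrite exchange_big /=.
have -> : (h ^ h)%:R = \sum_(s : h.-tuple 'I_h) 1 :> R.
  by rewrite sumr_const card_tuple card_ord.
rewrite big_distrl /= big_mkcond; apply: ler_sum => s _.
rewrite mul1r; case: ifP => ps; last first.
  by rewrite mulr_ge0 ?exprn_ge0 // divr_ge0 ?exprn_ge0 // addr_ge0.
rewrite -big_distrr /= ler_pM2l ?exprn_gt0 //.
rewrite -(bigA_distr_bigA (fun _ T => uniform_pmf R D T * x ^+ ch s T)) /=.
rewrite prodr_const card_ord; apply: lerXn2r; rewrite ?nnegrE.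
- by apply: sumr_ge0 => T _; rewrite mulr_ge0 ?uniform_pmf_ge0 ?exprn_ge0.
- by rewrite divr_ge0 ?exprn_ge0 ?addr_ge0.
(* Bounding the mass of every [T] by [1 / #|D|] extends the sum to all subsets, where the generating
   function is known exactly. *)
rewrite -(sum_changes_sets _ _ ps) big_distrl /=; apply: ler_sum => T _.
rewrite mulrC ler_wpM2l ?exprn_ge0 // /uniform_pmf.
by rewrite ler_piMl ?invr_ge0 // lern1 leq_b1.
Qed.

(** The left side is an [h]-th power whose base is at most [128 k / 4 ^ k], hence at most 1/2. *)
Lemma few_changes_bound k h : (6 <= k)%N -> h = (16 * k)%N ->
  (h ^ h)%:R * (8%:R ^+ (k * h + h) *
    ((1 + x) ^+ h / 'C(h, 8 * k)%:R) ^+ h) <= 2%:R^-1 ^+ k.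
Proof.
move=> k6 hE; have x0 : 0 <= x by rewrite invr_ge0.
set C : R := 'C(h, 8 * k)%:R.
have hC : 2%:R ^+ (8 * k) <= C.
  by rewrite -natrX ler_nat hE -[16%N]/(2 * 8)%N -mulnA central_binomial.
have C0 : 0 < C by apply: lt_le_trans hC; rewrite exprn_gt0.
have -> : (h ^ h)%:R * (8%:R ^+ (k * h + h) * ((1 + x) ^+ h / C) ^+ h) =
    (h%:R * (8%:R ^+ k.+1 * ((1 + x) ^+ h / C))) ^+ h.
  by rewrite natrX -[(k * h + h)%N]addnC -mulSn exprM -!exprMn.
(* This fails for [k = 5], whence the threshold 6. *)
have k4 : (256 * k <= 4 ^ k)%N.
  elim: (k) k6 => // k' IHk; rewrite leq_eqVlt => /orP[/eqP<- //|k6].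
  by rewrite expnS; have := IHk k6; lia.
have base : h%:R * (8%:R ^+ k.+1 * ((1 + x) ^+ h / C)) <= 2%:R^-1.
  apply: (@le_trans _ _ ((128 * k)%:R / 4%:R ^+ k)); last first.
    rewrite ler_pdivrMr ?exprn_gt0 // ler_pdivlMl // -natrX -natrM ler_nat.
    by rewrite mulnA.
  have -> : (128 * k)%:R / 4%:R ^+ k = h%:R * (8%:R ^+ k.+1 / 32%:R ^+ k) :> R.
    have -> : 32%:R ^+ k = 8%:R ^+ k * 4%:R ^+ k :> R by rewrite -exprMn -natrM.
    by rewrite exprS hE !natrM; field; rewrite !expf_neq0.
  rewrite ler_wpM2l // ler_wpM2l ?exprn_ge0 //.
  rewrite ler_pdivrMr // -ler_pdivrMl ?invr_gt0 ?exprn_gt0 // invrK.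
  (* As a comparison of [k]-th powers, this is [32 * (9/8)^16 <= 2^8]. *)
  apply: le_trans hC; rewrite hE !exprM -exprMn.
  apply: lerXn2r; rewrite ?nnegrE ?mulr_ge0 ?exprn_ge0 ?addr_ge0 //; lra.
apply: (@le_trans _ _ (2%:R^-1 ^+ h)).
  by apply: lerXn2r; rewrite ?nnegrE ?invr_ge0 // !mulr_ge0 ?exprn_ge0 ?addr_ge0 ?invr_ge0 ?ler0n // ltW.
apply: ler_wiXn2l; rewrite ?invr_ge0 ?invf_le1 ?ler1n // hE.
by lia.
Qed.
End Counting.

(** * The random instance *)

Lemma big_mE n : (0 < n)%N -> big_m n = ((n - 1) %/ 32 * 32)%N.
Proof.
move=> n0; apply/eqP; rewrite eqn_leq; apply/andP; split.
  apply/bigmax_leqP => i /dvdnP[q iq]; have := ltn_ord i; rewrite iq.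
  by move=> h; rewrite leq_mul2r leq_divRL // -ltnS -subSn // subn1.
have lt : ((n - 1) %/ 32 * 32 < n)%N.
  by apply: (leq_ltn_trans (leq_trunc_div _ _)); lia.
exact: (@leq_bigmax_cond _ (fun i : 'I_n => (32 %| i)%N) _ (Ordinal lt) (dvdn_mull _ (dvdnn _))).
Qed.

Lemma outputs_few_changes (R : realType) n (S : choices n) : (0 < n)%N ->
  (exists alg : algorithm R (vertex n),
     outputs_provably_lp (@uniform_oracle R (vertex n)) (random_graph S)
       alg (8 * ((n - 1) %/ 32) ^ 2)%N) ->
  few_changes (big_m n %/ 2)
    ((n - 1) %/ 32 * (big_m n %/ 2) + big_m n %/ 2) S.
Proof.
move=> n0 [alg [h [A [/run_history hrun plp]]]].
have [//|uh hsize] := hrun.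
have r0 : (0 < n - big_m n)%N.
  by rewrite big_mE // subn_gt0 (leq_ltn_trans (leq_trunc_div _ _)) // subn1 prednK.
pose u : vertex n := inr (Ordinal r0).
have u_univ i : i != u -> adj (random_graph S) u i.
  by case: i => [[i|i]|i] //= iu; apply: contraNneq iu => <-.
have einj : injective (fun j : 'I_(big_m n %/ 2) => inl (inr j) : vertex n).
  by move=> j j' [].
have [s ps hs] := pieces_order _ _ _ _ u_univ uh plp _ einj.
have ss : size s == (big_m n %/ 2)%N by rewrite (perm_size ps) size_enum_ord.
apply/existsP; exists (Tuple ss); rewrite ps /=.
(* One initial change is allowed per vertex of L. All others are paid for by cut points, two per
   query, and [2 * 8 k^2 = k * (16 k)]. *)
apply: (@leq_trans (\sum_(i < big_m n %/ 2)
    (size (cut_points (inl (inl i) : vertex n) h) + 1))).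
  by apply: leq_sum => i _; rewrite addn1; apply: (hs (inl (inl i))).
rewrite big_split /= sum_nat_const card_ord muln1 leq_add2r.
have := sum_size_cut_points h; rewrite !big_sumType /= => hsum.
have hE : (big_m n %/ 2 = 16 * ((n - 1) %/ 32))%N by rewrite big_mE //; lia.
apply: (@leq_trans (2 * size h)).
  by apply: leq_trans hsum; rewrite -addnA leq_addr.
rewrite add0n in hsize; rewrite hE mulnCA mulnn.
by rewrite -[16%N]/(2 * 8)%N -mulnA leq_mul2l.
Qed.

Theorem theorem1 (R : realType) :
  (fun n : nat =>
     choices_prob R (fun S : choices n =>
       ~ exists alg : algorithm R (vertex n),
           outputs_provably_lp (@uniform_oracle R (vertex n)) (random_graph S)
             alg (8 * ((n - 1) %/ 32) ^ 2)%N))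
  @ \oo --> (1 : R).
Proof.
apply/cvgrPdist_le => eps eps0.
have : (fun k : nat => 2%:R^-1 ^+ k : R) @ \oo --> (0 : R).
  by apply: cvg_expr; rewrite ger0_norm ?invr_ge0 // invf_lt1 ?ltr1n.
move=> /cvgrPdist_le /(_ _ eps0)[N _ hN].
(* This forces [k >= N + 6], giving both [2^-k <= eps] and [k >= 6]. *)
exists (32 * (N + 6) + 1)%N => // n /= nN.
have n0 : (0 < n)%N by lia.
set k := ((n - 1) %/ 32)%N.
have kN : (N <= k)%N by rewrite /k; lia.
have k6 : (6 <= k)%N by rewrite /k; lia.
have hE : (big_m n %/ 2 = 16 * k)%N by rewrite big_mE // /k; lia.
have aE : (big_m n %/ 4 = 8 * k)%N by rewrite big_mE // /k; lia.
set D := [set T : {set 'I_(big_m n %/ 2)} | #|T| == (big_m n %/ 4)%N]%SET.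
have cD : #|D| = 'C(big_m n %/ 2, 8 * k) by rewrite card_draws card_ord aE.
have tot : \sum_(S : choices n) choices_pmf R S = 1.
  rewrite -(bigA_distr_bigA (fun _ T => uniform_pmf R D T)) big1 // => i _.
  by rewrite sum_uniform_pmf // cD bin_gt0 hE; lia.
(* With 1 written as the total mass, the distance becomes the probability of the complementary
   event, which implies [few_changes]. *)
rewrite /choices_prob -[X in X - _]tot.
rewrite (bigID (fun S => `[< ~ exists alg : algorithm R (vertex n),
           outputs_provably_lp (@uniform_oracle R (vertex n)) (random_graph S)
             alg (8 * k ^ 2)%N >])) /= addrC addrK.
rewrite ger0_norm; last first.
  by apply: sumr_ge0 => S _; apply: prodr_ge0 => i _; exact: uniform_pmf_ge0.
have := hN k kN; rewrite sub0r normrN ger0_norm ?exprn_ge0 ?invr_ge0 //.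
apply: le_trans; apply: le_trans (few_changes_bound k _ k6 hE).
rewrite -cD; apply: le_trans (prob_few_changes _ _ D).
rewrite big_mkcond [leRHS]big_mkcond; apply: ler_sum => S _.
have pm0 : 0 <= choices_pmf R S by apply: prodr_ge0 => i _; exact: uniform_pmf_ge0.
case: asboolP => [_|/contrapT/(outputs_few_changes _ _ _ n0)->] //=.
by case: ifP.
Qed.
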